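(* For $n\ge 1$, the number $s_n^1(1342)$ of partial permutations of length $n$ with exactly one hole that avoid $1342$ equals $\binom{2n-2}{n-1}-\binom{2n-2}{n-5}$ (with $\binom{m}{j}=0$ for $j<0$).
   Context: A partial permutation of length $n$ with one hole is a sequence $\pi_1\cdots\pi_n$ in which each of $1,\dots,n-1$ appears exactly once and the remaining entry is a hole symbol $\diamond$. A permutation $\sigma$ of $[n]$ is an extension of $\pi$ if the standardization (order-preserving relabeling by $1,2,\dots$) of the restriction of $\sigma$ to the non-hole positions equals the restriction of $\pi$ to those positions. $\pi$ avoids a pattern $p$ if every extension of $\pi$ avoids $p$ in the classical sense. *)

(* Defs.v *)
From mathcomp Require Import all_boot all_order all_algebra all_fingroup.

Set Implicit Arguments.
Unset Strict Implicit.
Unset Printing Implicit Defensive.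

(* Order-preserving relabeling by 1, 2, ...; meant for sequences without
   repetition. *)
Definition standardize (s : seq nat) : seq nat :=
  [seq count (fun y => y <= x) s | x <- s].

Definition contains_pattern (p s : seq nat) : bool :=
  [exists m : (size s).-tuple bool, standardize (mask m s) == p].

Definition perm_avoids (p : seq nat) n (sigma : 'S_n) : bool :=
  ~~ contains_pattern p [seq (sigma i).+1 | i <- enum 'I_n].

(* Length-n words over {1, ..., n-1} and a hole symbol: [None] is the hole,
   and [Some v] with v : 'I_n.-1 stands for the letter v.+1. *)
Definition hole_word n := {ffun 'I_n -> option 'I_n.-1}.

Definition is_partial_perm1 n (pi : hole_word n) : bool :=
  [forall v : 'I_n.-1, #|[set i | pi i == Some v]| == 1]
  && (#|[set i | pi i == None]| == 1).

Definition nonhole_letters n (pi : hole_word n) : seq nat :=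
  pmap (fun i => omap (fun v : 'I_n.-1 => v.+1) (pi i)) (enum 'I_n).

Definition restrict_nonholes n (pi : hole_word n) (sigma : 'S_n) : seq nat :=
  [seq (sigma i).+1 | i <- enum 'I_n & pi i != None].

Definition is_extension n (pi : hole_word n) (sigma : 'S_n) : bool :=
  standardize (restrict_nonholes pi sigma) == nonhole_letters pi.

Definition partial_avoids (p : seq nat) n (pi : hole_word n) : bool :=
  [forall sigma : 'S_n, is_extension pi sigma ==> perm_avoids p sigma].

Definition num_avoiders1 (n : nat) (p : seq nat) : nat :=
  #|[set pi : hole_word n | is_partial_perm1 pi && partial_avoids p pi]|.

(* Binomial coefficient with an integer lower index, zero when it is
   negative. *)
Definition binomz (m : nat) (j : int) : nat :=
  if j is Posz k then 'C(m, k) else 0.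

(* Main.v *)
(** Let u and v be the words before and after the hole. Making the hole the
    letter 2, 1, 3 or 4 of a pattern shows that some extension contains 1342
    iff u contains 123, or v contains 231, or u v contains 132 with its 1 in u
    and its 2 in v; an occurrence avoiding the hole always yields one of these.

    The pairs (u, v) without such an occurrence grow by insertion of a new
    maximum. With x admissible sites in u and y in v, a pair labelled (x, y)
    with u nonempty has children (2, y), ..., (x + 1, y) and y copies of (1, 1);
    a pair with u empty has y children with u empty and labels 2, ..., y + 1,
    and the child (2, y). Both rules are solved by the ballot numbers of the
    Catalan tree, in which a node labelled k has children 2, ..., k + 1. *)
Require Import Defs.
From mathcomp Require Import all_boot all_order all_algebra all_fingroup.
From mathcomp Require Import zify.

Set Implicit Arguments.
Unset Strict Implicit.
Unset Printing Implicit Defensive.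

(** * The three label trees *)

(* [catalan_tree r k], [nonempty_tree r x y] and [empty_tree r y] count the
   descendants at depth [r] of a node with the given label. *)
Fixpoint catalan_tree r k :=
  if r is r'.+1 then \sum_(2 <= j < k.+2) catalan_tree r' j else 1.

Fixpoint nonempty_tree r x y :=
  if r is r'.+1 then
    \sum_(2 <= j < x.+2) nonempty_tree r' j y + y * nonempty_tree r' 1 1
  else 1.

Fixpoint empty_tree r y :=
  if r is r'.+1 then
    \sum_(2 <= j < y.+2) empty_tree r' j + nonempty_tree r' 2 y
  else 1.

Lemma catalan_treeS0 r : catalan_tree r.+1 0 = 0.
Proof. by rewrite /= big_geq. Qed.

Lemma catalan_treeS r k :
  catalan_tree r.+1 k.+1 = catalan_tree r.+1 k + catalan_tree r k.+2.
Proof. by rewrite /= big_nat_recr. Qed.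

(** The ballot numbers: [catalan_treeS] matches Pascal's rule for the difference of the two
    binomials, which vanishes at k = 0 by symmetry. Here and below, sums replace differences because
    subtraction on [nat] is truncated. *)
Lemma catalan_tree_bin r k :
  catalan_tree r.+1 k + 'C(r.*2.+1 + k, r) = 'C(r.*2.+1 + k, r.+1).
Proof.
elim: r k => [|r IHr] k; first by rewrite /= bin0 bin1 sum_nat_const_nat; lia.
elim: k => [|k IHk].
  rewrite catalan_treeS0 addn0 add0n -bin_sub; last by lia.
  by congr binomial; lia.
move: (IHr k.+2); rewrite (_ : r.*2.+1 + k.+2 = r.+1.*2.+1 + k); last by lia.
move: IHk; rewrite (catalan_treeS r.+1) addnS; move: (r.+1.*2.+1 + k) => N.
by rewrite (binS N r.+1) (binS N r); lia.
Qed.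

(** With one right site the rule is the Catalan rule shifted by one; each further right site
    contributes [catalan_tree r x.+2]. In x, both sides grow by the recurrence [catalan_treeS]. *)
Lemma nonempty_treeE r x y :
  nonempty_tree r.+1 x y.+1 = catalan_tree r.+1 x.+1 + y * catalan_tree r x.+2.
Proof.
elim: r x y => [|r IHr] x y; first by rewrite /= !sum_nat_const_nat; lia.
have H z : nonempty_tree r.+2 z y.+1 =
  \sum_(2 <= j < z.+2) nonempty_tree r.+1 j y.+1
    + y.+1 * nonempty_tree r.+1 1 1 by [].
elim: x => [|x IHx].
  (* At x = 0 only the y + 1 children labelled (1, 1) remain. *)
  by rewrite H big_geq // IHr (catalan_treeS r.+1 0) catalan_treeS0; lia.
have {}H : nonempty_tree r.+2 x.+1 y.+1 =
          nonempty_tree r.+2 x y.+1 + nonempty_tree r.+1 x.+2 y.+1.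
  by rewrite !H (@big_nat_recr _ _ _ x.+2) // addnAC.
rewrite H.
by rewrite IHx IHr (catalan_treeS r.+1 x.+1) (catalan_treeS r x.+2); lia.
Qed.

(** In y, both sides grow by the Catalan recurrence: the term [catalan_tree r 4] that the nonempty
    child adds at each step cancels the one in the induction hypothesis. *)
Lemma empty_treeE r y :
  empty_tree r.+1 y.+1 + catalan_tree r 4 =
  catalan_tree r.+1 y.+2 + catalan_tree r y.+4.+1.
Proof.
elim: r y => [|r IHr] y; first by rewrite /= !sum_nat_const_nat; lia.
have H z : empty_tree r.+2 z =
  \sum_(2 <= j < z.+2) empty_tree r.+1 j + nonempty_tree r.+1 2 z by [].
elim: y => [|y IHy].
  rewrite H big_nat1 nonempty_treeE.
  have := catalan_treeS0 r.+1.
  move: (IHr 1) (catalan_treeS r.+1 1) (catalan_treeS r.+1 0).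
  by move: (catalan_treeS r 2) (catalan_treeS r 4); lia.
have {}H : empty_tree r.+2 y.+2 =
    empty_tree r.+2 y.+1 + empty_tree r.+1 y.+3 + catalan_tree r 4.
  (* [catalan_tree r 4] is the slope of [nonempty_tree r.+1 2 y] in y. *)
  by rewrite !H (@big_nat_recr _ _ _ y.+3) // !nonempty_treeE mulSn /=; lia.
rewrite H; move: (IHr y.+2) IHy.
by rewrite (catalan_treeS r.+1 y.+2) (catalan_treeS r y.+4.+1); lia.
Qed.

(** The root count is [catalan_tree m.+4 2 + catalan_tree m.+2 6]. With N = 2(m + 4), Pascal's rule
    turns these into C(N, m+4) - C(N, m+2) and C(N, m+2) - C(N, m), and the sum telescopes. *)
Lemma empty_tree_root m :
  empty_tree m.+4 1 + 'C(m.+4.*2, m) = 'C(m.+4.*2, m.+4).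
Proof.
have := empty_treeE m.+3 0; rewrite (catalan_treeS m.+2 4) => H.
move: (catalan_tree_bin m.+3 2) (catalan_tree_bin m.+1 6) H.
rewrite (_ : m.+3.*2.+1 + 2 = m.+4.*2.+1); last by lia.
rewrite (_ : m.+1.*2.+1 + 6 = m.+4.*2.+1); last by lia.
move: m.+4.*2 => N; rewrite !(binS N); lia.
Qed.

Lemma empty_tree_binz n :
  ((empty_tree n 1)%:Z =
   (binomz (2 * n.+1 - 2)%N (n.+1%:Z - 1))%:Z
     - (binomz (2 * n.+1 - 2)%N (n.+1%:Z - 5))%:Z)%R.
Proof.
have -> : (n.+1%:Z - 1 = n%:Z)%R by lia.
have -> : 2 * n.+1 - 2 = n.*2 by lia.
(* For n < 4 the lower index n + 1 - 5 is negative and the second term is zero; these four cases are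
   computed. *)
case: n => [|[|[|[|m]]]]; last first.
  have -> : (m.+4.+1%:Z - 5 = m%:Z)%R by lia.
  by rewrite /binomz; have := empty_tree_root m; lia.
all: by rewrite /= ?unlock.
Qed.

(** * Inserting a new maximum *)

Lemma subseq_catE (T : eqType) (t s1 s2 : seq T) :
  subseq t (s1 ++ s2) ->
  exists t1 t2, [/\ t = t1 ++ t2, subseq t1 s1 & subseq t2 s2].
Proof.
case/subseqP=> m sz_m ->.
exists (mask (take (size s1) m) s1), (mask (drop (size s1) m) s2).
rewrite !mask_subseq -mask_cat ?cat_take_drop // size_takel //.
by rewrite sz_m size_cat leq_addr.
Qed.

Lemma subseq_cat_consE (T : eqType) (t s1 s2 : seq T) x :
  subseq t (s1 ++ x :: s2) ->
  subseq t (s1 ++ s2) \/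
  exists t1 t2, [/\ t = t1 ++ x :: t2, subseq t1 s1 & subseq t2 s2].
Proof.
case/subseq_catE=> t1 [[|y t2] [-> t1s1 t2s2]].
  by left; rewrite cat_subseq ?sub0seq.
move: t2s2; rewrite [subseq _ (_ :: _)]/=; case: eqP => [->|_] t2s2.
  by right; exists t1, t2.
by left; rewrite cat_subseq.
Qed.

Lemma pairwise_subseqP (T : eqType) (r : rel T) s :
  reflect (forall x y, subseq [:: x; y] s -> r x y) (pairwise r s).
Proof.
apply: (iffP idP) => [rs x y /subseq_pairwise/(_ rs)|].
  by rewrite /= !andbT.
elim: s => //= x s IHs rs; apply/andP; split; last first.
  by apply: IHs => y z yzs; apply: rs; case: eqP yzs => // _ /cons_subseq.
by apply/allP=> y ys; apply: rs; rewrite eqxx sub1seq.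
Qed.

Lemma subseq_cat_cons (T : eqType) (s1 s2 : seq T) x :
  subseq (s1 ++ s2) (s1 ++ x :: s2).
Proof. by rewrite cat_subseq // subseq_cons. Qed.

(* The hole plays the letter 2, 1, 3, 4 of the pattern 1342, respectively. *)
Definition good (u v : seq nat) : Prop :=
  [/\ forall x y z, subseq [:: x; y; z] u -> ~~ (x < y < z),
      forall x y z, subseq [:: x; y; z] v -> ~~ (z < x < y),
      forall x y z, x \in u -> subseq [:: y; z] v -> ~~ (x < z < y)
    & forall x y z, subseq [:: x; y] u -> z \in v -> ~~ (x < z < y)].

(** In a forbidden occurrence [M] can only be the largest letter: the 3 of a 123 in the left word,
    or the 3 of a 132 whose 2 lies in [v]. The two conditions on [u1] exclude exactly these. *)
Lemma good_insertl M u1 u2 v : (forall x, x \in u1 ++ u2 ++ v -> x < M) ->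
  good (u1 ++ M :: u2) v <->
  good (u1 ++ u2) v /\ pairwise geq u1 && allrel geq u1 v.
Proof.
move=> ltM; have ss := subseq_cat_cons u1 u2 M.
have ltM1 x : x \in u1 -> x < M by move=> ?; apply: ltM; rewrite mem_cat; lia.
have ltM2 x : x \in u2 -> x < M by move=> ?; apply: ltM; rewrite !mem_cat; lia.
have ltMv x : x \in v -> x < M by move=> ?; apply: ltM; rewrite !mem_cat; lia.
split=> [[g1 g2 g3 g4]|[[g1 g2 g3 g4] /andP[/pairwise_subseqP d1 /allrelP d2]]].
  split; first split=> //.
  - by move=> x y z /subseq_trans/(_ ss); apply: g1.
  - by move=> x y z /(mem_subseq ss); apply: g3.
  - by move=> x y z /subseq_trans/(_ ss); apply: g4.
  apply/andP; split.
    apply/pairwise_subseqP=> x y xy; rewrite /= leqNgt.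
    apply: contraNN (g1 x y M _) => [->/=|].
      by apply: ltM1; apply: (mem_subseq xy); rewrite !inE eqxx orbT.
    by rewrite (_ : [:: x; y; M] = [:: x;
      y] ++ [:: M]) // cat_subseq // sub1seq mem_head.
  apply/allrelP=> x y xu yv; rewrite /= leqNgt.
  apply: contraNN (g4 x M y _ yv) => [->/=|]; first exact: ltMv.
  rewrite (_ : [:: x; M] = [:: x] ++ [:: M]) //.
  by rewrite cat_subseq ?sub1seq ?mem_head.
split=> //.
(* The length of [t1] tells which letter of the occurrence is [M]; the maximality of [M] rules out
   all but the largest. *)
- move=> x y z /subseq_cat_consE[/g1//|[t1 [t2 []]]];
    case: t1 => [|a [|b [|c [|d t1]]]] // [].
  + by move=> -> <- _ ins; have := ltM2 y (mem_subseq ins (mem_head _ _)); lia.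
  + move=> _ -> <- _ ins; have := ltM2 z (mem_subseq ins (mem_head _ _)); lia.
  + by move=> -> -> _ _ ins _; have := d1 _ _ ins; rewrite /=; lia.
- move=> x y z; rewrite mem_cat inE orbCA => /orP[/eqP->|].
    by move=> /mem_subseq/(_ z) ins; have := ltMv z;
      rewrite ins ?inE ?eqxx ?orbT //; lia.
  by rewrite -mem_cat; apply: g3.
- move=> x y z /subseq_cat_consE[/g4|[t1 [t2 []]]]; first exact;
    case: t1 => [|a [|b [|c t1]]] // [].
    by move=> -> _ _ _ /ltMv; lia.
  by move=> -> _ _; rewrite sub1seq => xu _ zv; have := d2 _ _ xu zv;
    rewrite /=; lia.
Qed.

(** Here [M] can only be the 3 of a 231 in the right word, or the 3 of a 132 whose 1 lies in [u] and
    whose 2 lies in [v2]. *)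
Lemma good_insertr M u v1 v2 : (forall x, x \in u ++ v1 ++ v2 -> x < M) ->
  good u (v1 ++ M :: v2) <->
  good u (v1 ++ v2) /\ allrel leq v1 v2 && allrel geq u v2.
Proof.
move=> ltM; have ss := subseq_cat_cons v1 v2 M.
have ltM1 x : x \in v1 -> x < M by move=> ?; apply: ltM; rewrite !mem_cat; lia.
have ltM2 x : x \in v2 -> x < M by move=> ?; apply: ltM; rewrite !mem_cat; lia.
have ltMu x : x \in u -> x < M by move=> ?; apply: ltM; rewrite !mem_cat; lia.
split=> [[g1 g2 g3 g4]|[[g1 g2 g3 g4] /andP[/allrelP d1 /allrelP d2]]].
  split; first split=> //.
  - by move=> x y z /subseq_trans/(_ ss); apply: g2.
  - by move=> x y z xu /subseq_trans/(_ ss); apply: g3.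
  - by move=> x y z xu /(mem_subseq ss); apply: g4.
  apply/andP; split; apply/allrelP=> x y xin yin; rewrite /= leqNgt.
    apply: contraNN (g2 x M y _) => [->/=|]; first exact: ltM1.
    rewrite (_ : [:: x; M; y] = [:: x] ++ [:: M; y]) //.
    by rewrite cat_subseq ?sub1seq //= eqxx sub1seq.
  apply: contraNN (g3 x M y xin _) => [->/=|]; first exact: ltM2.
  by rewrite -[[:: M; y]]cat0s cat_subseq ?sub0seq //= eqxx sub1seq.
split=> //.
- move=> x y z /subseq_cat_consE[/g2//|[t1 [t2 []]]];
    case: t1 => [|a [|b [|c [|d t1]]]] // [].
  + by move=> -> <- _ ins; have := ltM2 y (mem_subseq ins (mem_head _ _)); lia.
  + move=> -> -> <-; rewrite !sub1seq => xv zv; have := d1 _ _ xv zv; lia.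
  + by move=> -> -> -> _ ins _;
      have := ltM1 a (mem_subseq ins (mem_head _ _)); lia.
- move=> x y z xu /subseq_cat_consE[/(g3 _ _ _ xu)//|[t1 [t2 []]]];
    case: t1 => [|a [|b [|c t1]]] // [].
    by move=> _ <-; rewrite sub1seq => _ zv; have := d2 _ _ xu zv; rewrite /=;
      lia.
  by move=> -> -> _; rewrite sub1seq => /ltM1; lia.
- move=> x y z xyu; rewrite mem_cat inE orbCA => /orP[/eqP->|].
    by have := ltMu y; rewrite (mem_subseq xyu) ?inE ?eqxx ?orbT //; lia.
  by rewrite -mem_cat; apply: g4.
Qed.

(** * The generating tree of good pairs *)

Definition insert_at (M p : nat) (s : seq nat) := take p s ++ M :: drop p s.

(* [lsite u v p] and [rsite u v q] say that a new maximum can be inserted at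
   position [p] of [u], resp. [q] of [v], without spoiling [good u v]. *)
Definition lsite u v p := pairwise geq (take p u) && allrel geq (take p u) v.

Definition rsite u v q :=
  allrel leq (take q v) (drop q v) && allrel geq u (drop q v).

Definition lsites u v := [seq p <- iota 0 (size u).+1 | lsite u v p].
Definition rsites u v := [seq q <- iota 0 (size v).+1 | rsite u v q].

(* A code is the side of the insertion ([true] for the left word) together with
   its position. *)
Definition child M (g : seq nat * seq nat) (c : bool * nat) :=
  if c.1 then (insert_at M c.2 g.1, g.2) else (g.1, insert_at M c.2 g.2).

Definition codes (g : seq nat * seq nat) : seq (bool * nat) :=
  [seq (true, p) | p <- lsites g.1 g.2] ++
  [seq (false, q) | q <- rsites g.1 g.2].

Fixpoint good_pairs m : seq (seq nat * seq nat) :=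
  if m is m'.+1 then [seq child m'.+1 g c | g <- good_pairs m', c <- codes g]
  else [:: ([::], [::])].

Lemma perm_insert_at M p s : perm_eq (insert_at M p s) (M :: s).
Proof. by rewrite /insert_at perm_catC /= perm_cons perm_catC cat_take_drop.
  Qed.

Lemma insert_at_index M s :
  M \in s -> exists p t, p <= size t /\ s = insert_at M p t.
Proof.
case/splitPr=> s1 s2; exists (size s1), (s1 ++ s2).
by rewrite size_cat leq_addr /insert_at take_size_cat // drop_size_cat.
Qed.

Lemma insert_at_inj M p q s t : M \notin s -> M \notin t ->
  p <= size s -> q <= size t ->
  insert_at M p s = insert_at M q t -> s = t /\ p = q.
Proof.
move=> Ms Mt ps qt E.
have idx k r : M \notin r -> k <= size r -> index M (insert_at M k r) = k.
  move=> Mr kr;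
    rewrite /insert_at index_cat ifN ?size_takel //= ?eqxx ?addn0 //.
  by apply: contra Mr => /mem_take.
have pq : p = q by rewrite -(idx p s) // E idx.
split=> //; move/eqP: E; rewrite {}pq in ps *.
rewrite /insert_at eqseq_cat ?size_takel // => /andP[/eqP E1 /eqP[E2]].
by rewrite -(cat_take_drop q s) E1 E2 cat_take_drop.
Qed.

Lemma mem_codes u v c : c \in codes (u, v) =
  (c.2 <= (if c.1 then size u else size v)) &&
  (if c.1 then lsite u v c.2 else rsite u v c.2).
Proof.
have mem_pair b b' p (s : seq nat) :
    ((b, p) \in [seq (b', q) | q <- s]) = (b == b') && (p \in s).
  case: eqVneq => [->|/eqP bb']; first by rewrite mem_map // => x y [].
  by apply/mapP=> -[q _ []].
by case: c => [[] p]; rewrite mem_cat !mem_pair ?orbF /= mem_filter mem_iota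
  ltnS andbC.
Qed.

Lemma good_child M u v c :
    (forall x, x \in u ++ v -> x < M) ->
    c.2 <= (if c.1 then size u else size v) ->
  good (child M (u, v) c).1 (child M (u, v) c).2 <->
  good u v /\ c \in codes (u, v).
Proof.
move=> ltM; rewrite mem_codes => csz; rewrite csz.
case: c csz => [[] p] _; rewrite /child /insert_at /=.
  by rewrite good_insertl ?cat_take_drop // catA cat_take_drop.
by rewrite good_insertr ?cat_take_drop.
Qed.

Lemma perm_child M u v c :
  perm_eq ((child M (u, v) c).1 ++ (child M (u, v) c).2) (M :: u ++ v).
Proof.
case: c => [[] p]; rewrite /child /=.
  by rewrite -cat_cons perm_cat2r perm_insert_at.
rewrite perm_catC (perm_trans (_ : perm_eq _ ((M :: v) ++ u))) //.
  by rewrite perm_cat2r perm_insert_at.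
by rewrite /= perm_cons perm_catC.
Qed.

Lemma perm_iotaS m s :
  perm_eq (m.+1 :: s) (iota 1 m.+1) = perm_eq s (iota 1 m).
Proof.
by rewrite -[X in iota 1 X]addn1 iotaD perm_sym perm_catC /= perm_cons perm_sym.
Qed.

Lemma perm_iota_lt m s x : perm_eq s (iota 1 m) -> x \in s -> x < m.+1.
Proof. by move/perm_mem=> ->; rewrite mem_iota add1n => /andP[]. Qed.

(** Deleting the maximum of a good pair leaves a good pair, so growing level by level through
    admissible sites misses nothing. *)
Lemma mem_good_pairs m u v :
  (u, v) \in good_pairs m <-> perm_eq (u ++ v) (iota 1 m) /\ good u v.
Proof.
elim: m u v => [|m IHm] u v.
  rewrite inE; split=> [/eqP[-> ->]|[/perm_size]]; first by [].
  by rewrite size_cat; case: u; case: v.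
have lt_gen := perm_iota_lt (m := m).
split => [/allpairsPdep[[u' v'] [c [/IHm[p' g'] cc E]]]|[pm g]].
  have [-> ->] : u = (child m.+1 (u', v') c).1 /\ v = (child m.+1 (u', v') c).2.
    by rewrite -E.
  split; first by rewrite (permPl (perm_child _ _ _ _)) perm_iotaS.
  rewrite good_child // => [x|]; first exact: lt_gen.
  by move: cc; rewrite mem_codes => /andP[].
have : m.+1 \in u ++ v by rewrite (perm_mem pm) mem_iota; lia.
have ex_child : m.+1 \in u ++ v -> exists u' v' c,
    [/\ u = (child m.+1 (u', v') c).1, v = (child m.+1 (u', v') c).2
      & c.2 <= (if c.1 then size u' else size v')].
  rewrite mem_cat => /orP[]/insert_at_index[p [t [pt ->]]].
    by exists t, v, (true, p).
  by exists u, t, (false, p).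
move/ex_child=> [u' [v' [c [Eu Ev csz]]]]; move: pm g.
rewrite {}Eu {}Ev (permPl (perm_child _ _ _ _)) perm_iotaS => pm.
rewrite good_child // => [[g cc]|x]; last exact: lt_gen.
rewrite -surjective_pairing; apply/allpairsPdep; exists (u', v'), c; split=> //.
exact/IHm.
Qed.

(** The side and the position of the maximum determine the code and the parent. *)
Lemma uniq_good_pairs m : uniq (good_pairs m).
Proof.
elim: m => //= m IHm; apply: allpairs_uniq_dep => // [[u v] _|].
  rewrite cat_uniq !map_inj_uniq ?filter_uniq ?iota_uniq //;
    try by move=> x y [].
  by rewrite andbT; apply/hasPn=> _ /mapP[p _ ->]; apply/mapP=> -[].
have notin s : perm_eq s (iota 1 m) -> m.+1 \notin s.
  by move=> ps; apply/negP=> /(perm_iota_lt ps); rewrite ltnn.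
move=> x y /allpairsPdep[[u v] [c [/mem_good_pairs[p _] cc ->]]].
move=> /allpairsPdep[[u' v'] [c' [/mem_good_pairs[p' _] cc' ->]]] /=.
move: cc cc' (notin _ p) (notin _ p'); rewrite !mem_codes !mem_cat !negb_or.
case: c c' => [[] i] [[] j] /= /andP[le_i _] /andP[le_j _].
- move=> /andP[Mu Mv] /andP[Mu' Mv'] [E ->].
  by have [-> ->] := insert_at_inj Mu Mu' le_i le_j E.
- move=> /andP[Mu Mv] /andP[Mu' Mv'] [E _].
  by case/negP: Mu'; rewrite -E (perm_mem (perm_insert_at _ _ _)) mem_head.
- move=> /andP[Mu Mv] /andP[Mu' Mv'] [E _].
  by case/negP: Mu; rewrite E (perm_mem (perm_insert_at _ _ _)) mem_head.
move=> /andP[Mu Mv] /andP[Mu' Mv'] [-> E].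
by have [-> ->] := insert_at_inj Mv Mv' le_i le_j E.
Qed.

(** * Labels of the generating tree *)

(* Number of descendants of [g] at depth [r] in the generating tree. *)
Definition tree_size r (g : seq nat * seq nat) :=
  if g.1 is [::] then empty_tree r (size (rsites g.1 g.2))
  else nonempty_tree r (size (lsites g.1 g.2)) (size (rsites g.1 g.2)).

(* The last site up to and including the site [q] has rank
   [count P (iota 0 q.+1)], so the ranks of the sites are 1, 2, and so on. *)
Lemma sum_rank (P : pred nat) (F : nat -> nat) n :
  \sum_(q <- iota 0 n | P q) F (count P (iota 0 q.+1)) =
  \sum_(1 <= j < (count P (iota 0 n)).+1) F j.
Proof.
have iotaSr k : iota 0 k.+1 = iota 0 k ++ [:: k] by rewrite -addn1 iotaD.
elim: n => [|n IHn]; first by rewrite big_nil big_geq.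
rewrite iotaSr big_cat big_cons big_nil {}IHn -/(iota 0 n.+1) iotaSr count_cat
  /=.
case: (P n); last by rewrite !addn0.
by rewrite !addn0 addn1 [RHS]big_nat_recr.
Qed.

Lemma take_insert_at M p q s : q <= p <= size s ->
  take q (insert_at M p s) = take q s.
Proof.
by move=> /andP[qp ps]; rewrite /insert_at takel_cat ?size_takel // take_takel.
Qed.

Lemma drop_insert_at M p q s : q <= p <= size s ->
  perm_eq (drop q (insert_at M p s)) (M :: drop q s).
Proof.
move=> qps; rewrite -(perm_cat2l (take q s)) -{1}(take_insert_at M qps).
rewrite cat_take_drop (permPl (perm_insert_at _ _ _)).
by rewrite perm_sym perm_catC /= perm_cons perm_catC cat_take_drop.
Qed.

Lemma mem_take_insert_at M p q s : p < q -> M \in take q (insert_at M p s).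
Proof.
move=> pq; rewrite /insert_at -cat_rcons take_cat size_rcons size_take_min ifN.
  by rewrite mem_cat mem_rcons mem_head.
by lia.
Qed.

(** A leading maximum dominates both words, so each old site survives shifted by one, and position 0
    is new. *)
Lemma size_lsites_insert0 M (u v : seq nat) : (forall x, x \in u ++ v -> x < M)
  ->
  size (lsites (insert_at M 0 u) v) = (size (lsites u v)).+1.
Proof.
move=> ltM; rewrite /lsites !size_filter /insert_at take0 drop0 cat0s.
have -> : iota 0 (size (M :: u)).+1 = 0 :: map succn (iota 0 (size u).+1).
  by rewrite -(iotaDl 1 0).
rewrite -[0 :: _]cat1s count_cat count_map add1n; congr _.+1.
apply: eq_count => p; rewrite /lsite /=.
rewrite [all (leq^~ M) _](_ : _ = true) /=; last first.
  by apply/allP=> x /mem_take xu; rewrite ltnW // ltM // mem_cat xu.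
rewrite allrel_consl [X in _ && (X && _)](_ : _ = true) //.
by apply/allP=> x xv /=; rewrite ltnW // ltM // mem_cat xv orbT.
Qed.

(** Up to [p] the prefixes are unchanged; any longer prefix contains [M] after the smaller first
    letter of [u]. *)
Lemma size_lsites_insert M (u v : seq nat) p : (forall x, x \in u -> x < M) ->
  0 < p <= size u ->
  size (lsites (insert_at M p u) v) = count (lsite u v) (iota 0 p.+1).
Proof.
move=> ltM /andP[p0 pu]; rewrite /lsites size_filter.
rewrite (perm_size (perm_insert_at _ _ _)).
have -> : (size (M :: u)).+1 = p.+1 + (size u - p).+1 by rewrite /=; lia.
rewrite iotaD count_cat [X in _ + X](_ : _ = 0) ?addn0.
  apply: eq_in_count => q; rewrite mem_iota /= => qp.
  by rewrite /lsite take_insert_at //; lia.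
apply/eqP; rewrite -leqn0 leqNgt -has_count; apply/hasPn=> q.
rewrite mem_iota => /andP[pq _]; rewrite /lsite negb_and; apply/orP; left.
case: u pu ltM => [|x u] pu ltM; first by case: p p0 pu {pq}.
case: p p0 pq {pu} => // p _; case: q => // q pq.
apply/negP=> /= /andP[/allP/(_ M)].
by rewrite mem_take_insert_at //= leqNgt ltM ?mem_head // => /(_ isT).
Qed.

(** Each letter of [u] is now below a letter of the right word, so only the empty prefix is
    allowed. *)
Lemma size_lsites_insertr M (u v : seq nat) q : (forall x, x \in u -> x < M) ->
  size (lsites u (insert_at M q v)) = 1.
Proof.
move=> ltM; rewrite /lsites size_filter /= addnC.
rewrite [count _ _](_ : _ = 0) ?/lsite ?take0 //.
apply/eqP; rewrite -leqn0 leqNgt -has_count; apply/hasPn=> p.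
rewrite mem_iota; case: u ltM => [|x u] ltM /=; first by case: p.
case: p => // p _; rewrite /lsite /= negb_and; apply/orP; right.
apply/negP=> /andP[/allP/(_ M)].
rewrite (perm_mem (perm_insert_at _ _ _)) mem_head /= leqNgt ltM ?mem_head //.
by move/(_ isT).
Qed.

Lemma size_rsites_insertl M (u v : seq nat) p : (forall x, x \in v -> x < M) ->
  size (rsites (insert_at M p u) v) = size (rsites u v).
Proof.
move=> ltM; rewrite /rsites !size_filter.
apply: eq_count => q; rewrite /rsite; congr (_ && _).
rewrite (@eq_allrel_meml _ _ _ _ (M :: u)); last exact/perm_mem/perm_insert_at.
rewrite allrel_consl [X in X && _](_ : _ = true) //.
by apply/allP=> x /mem_drop/ltM/ltnW.
Qed.

Lemma rsite_size u v : rsite u v (size v).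
Proof. by rewrite /rsite drop_size !allrel0r. Qed.

Lemma lsite0 u v : lsite u v 0.
Proof. by rewrite /lsite take0. Qed.

(** Such a cut has [M] on its left and, not being at the end, a smaller letter on its right. *)
Lemma rsite_insert_gt M (u v : seq nat) q q' : (forall x, x \in v -> x < M) ->
  q < q' <= size v -> rsite u (insert_at M q v) q' = false.
Proof.
move=> ltM /andP[qq' q'v]; apply/negP=> /andP[/allrelP/(_ M)+ _].
have : 0 < size (drop q' (insert_at M q v)).
  by rewrite size_drop (perm_size (perm_insert_at _ _ _)) /=; lia.
case E: (drop _ _) => [//|x s] _ /(_ x); rewrite mem_take_insert_at // mem_head.
move=> /(_ isT isT); rewrite leqNgt ltM //.
move: (mem_head x s); rewrite -E /insert_at drop_cat size_take.
case: (ltnP q (size v)) => [qv|]; last by lia.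
rewrite ltnNge ltnW //=; case: (q' - q) (subn_gt0 q q') => [|k];
  rewrite qq' //= => _.
by move=> /mem_drop/mem_drop.
Qed.

(** The extra site is the end of the word; the other survivors lie at or before [M]. *)
Lemma size_rsites_insertr M (u v : seq nat) q : (forall x, x \in v -> x < M) ->
  q <= size v ->
  size (rsites u (insert_at M q v)) =
    (count (rsite u (insert_at M q v)) (iota 0 q.+1)).+1.
Proof.
move=> ltM qv; have szv : size (insert_at M q v) = (size v).+1.
  exact: (perm_size (perm_insert_at _ _ _)).
rewrite /rsites size_filter szv.
have -> : (size v).+2 = q.+1 + (size v - q + 1) by lia.
rewrite !iotaD !count_cat.
rewrite [count _ (iota (0 + q.+1) _)](_ : _ = 0); last first.
  apply/eqP; rewrite -leqn0 leqNgt -has_count; apply/hasPn=> q'.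
  by rewrite mem_iota => q'v; rewrite rsite_insert_gt //; lia.
have -> : 0 + q.+1 + (size v - q) = (size v).+1 by lia.
by rewrite [count _ (iota _ 1)]/= -szv rsite_size addn1.
Qed.

(** A cut at or before [M] leaves [M] in the suffix, above the letter [x] of the left word. Only the
    end remains, whence the label 1. *)
Lemma size_rsites_insertr_cons M x (u v : seq nat) q : x < M ->
  (forall y, y \in v -> y < M) -> q <= size v ->
  size (rsites (x :: u) (insert_at M q v)) = 1.
Proof.
move=> xM ltM qv; rewrite size_rsites_insertr //; congr _.+1.
apply/eqP; rewrite -leqn0 leqNgt -has_count; apply/hasPn=> q'.
rewrite mem_iota ltnS => q'q; apply/negP=> /andP[_ /allrelP/(_ x M)].
rewrite mem_head (perm_mem (drop_insert_at _ _)) ?qv ?andbT // mem_head.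
by rewrite /= leqNgt xM => /(_ isT isT).
Qed.

(** With no left word, a larger letter in the suffix spoils no cut at or before [M]. Inserting at
    the site of rank j thus gives the label j + 1. *)
Lemma size_rsites_insertr_nil M (v : seq nat) q : (forall x, x \in v -> x < M)
  ->
  q <= size v ->
  size (rsites [::] (insert_at M q v)) =
    (count (rsite [::] v) (iota 0 q.+1)).+1.
Proof.
move=> ltM qv; rewrite size_rsites_insertr //; congr _.+1.
apply: eq_in_count => q'; rewrite mem_iota ltnS => q'q.
rewrite /rsite !allrel0l !andbT take_insert_at ?qv ?andbT //.
rewrite (@eq_allrel_memr _ _ _ _ _ (M :: drop q' v)); last first.
  by apply/perm_mem/drop_insert_at; rewrite qv andbT.
rewrite allrel_consr [X in X && _](_ : _ = true) //.
by apply/allP=> x /mem_take/ltM/ltnW.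
Qed.

(** Site 0, of rank 1, yields the label x + 1; a site of rank j > 1 yields j. *)
Lemma sum_lsites M (u v : seq nat) (F : nat -> nat) : (forall x, x \in u ++ v
  -> x < M) ->
  \sum_(p <- lsites u v) F (size (lsites (insert_at M p u) v)) =
  \sum_(2 <= j < (size (lsites u v)).+2) F j.
Proof.
move=> ltM; have := sum_rank (lsite u v) F (size u).+1.
have iota0 : iota 0 (size u).+1 = 0 :: iota 1 (size u) by [].
have x_gt0 : size (lsites u v) = (size (lsites u v)).-1.+1.
  by rewrite /lsites iota0 /= lsite0.
rewrite -size_filter -/(lsites u v) x_gt0 iota0 big_cons lsite0 big_ltn //.
have -> : count (lsite u v) (iota 0 1) = 1 by rewrite /= lsite0.
(* The term F 1 that site 0 has in [sum_rank] is cancelled and replaced by the last term, F (x +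
   1). *)
move=> /addnI eqF; rewrite big_nat_recr //= -{}eqF -x_gt0 addnC.
rewrite /lsites iota0 big_filter big_cons lsite0 -iota0 -/(lsites u v).
rewrite size_lsites_insert0 //.
congr (_ + _); rewrite big_seq_cond [RHS]big_seq_cond; apply: eq_bigr => p.
rewrite mem_iota => /andP[p_u _]; rewrite size_lsites_insert /= ?lsite0 //.
by move=> x xu; apply: ltM; rewrite mem_cat xu.
Qed.

Lemma tree_size_nonempty r g : g.1 != [::] ->
  tree_size r g =
  nonempty_tree r (size (lsites g.1 g.2)) (size (rsites g.1 g.2)).
Proof. by case: g => [[]]. Qed.

Lemma tree_size_child M r g : (forall x, x \in g.1 ++ g.2 -> x < M) ->
  \sum_(c <- codes g) tree_size r (child M g c) = tree_size r.+1 g.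
Proof.
case: g => u v /= ltM; rewrite big_cat !big_map /=.
have ltMu x : x \in u -> x < M by move=> xu; rewrite ltM // mem_cat xu.
have ltMv x : x \in v -> x < M by move=> xv; rewrite ltM // mem_cat xv orbT.
have -> : \sum_(p <- lsites u v) tree_size r (child M (u, v) (true, p)) =
    \sum_(2 <= j < (size (lsites u v)).+2) nonempty_tree r j (size (rsites u
      v)).
  rewrite -(sum_lsites (fun j => nonempty_tree r j _) ltM).
  apply: eq_bigr => p _; rewrite tree_size_nonempty /= ?size_rsites_insertl //.
  by rewrite -size_eq0 (perm_size (perm_insert_at _ _ _)).
rewrite [X in _ + X]big_seq; case: u => [|x u] in ltM ltMu *.
  have -> : size (lsites [::] v) = 1 by [].
  rewrite big_nat1 /= addnC; congr (_ + _).
  rewrite big_add1 /= [in RHS]/rsites size_filter.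
  rewrite -(sum_rank _ (fun j => empty_tree r j.+1)) -[RHS]big_filter.
  rewrite [RHS]big_seq.
  apply: eq_bigr => q qv; rewrite /tree_size /= size_rsites_insertr_nil //.
  by move: qv; rewrite mem_filter mem_iota => /andP[].
rewrite [RHS]/=; congr (_ + _).
rewrite (eq_bigr (fun=> nonempty_tree r 1 1)) => [|q qv].
  by rewrite -big_seq big_const_seq count_predT iter_addn_0 mulnC.
rewrite tree_size_nonempty // [child _ _ _]/= [fst _]/= [snd _]/=
  size_lsites_insertr //.
rewrite size_rsites_insertr_cons ?ltMu ?mem_head //.
by move: qv; rewrite mem_filter mem_iota => /andP[].
Qed.

Lemma size_good_pairs m : size (good_pairs m) = empty_tree m 1.
Proof.
(* The number of nodes at depth k + r can be counted from any level k; the proof then compares level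
   0 with level m at r = 0. *)
have H k : forall r, \sum_(g <- good_pairs k) tree_size r g = empty_tree (k +
  r) 1.
  elim: k => [|k IHk] r; first by rewrite big_seq1.
  rewrite addSnnS -IHk [good_pairs _]/= big_allpairs_dep big_seq [RHS]big_seq.
  apply: eq_bigr => g; rewrite [g]surjective_pairing => /mem_good_pairs[pg _].
  by apply: tree_size_child => x; apply: perm_iota_lt.
rewrite -[m in RHS]addn0 -H big_tnth.
rewrite (eq_bigr (fun=> 1)) ?sum1_card ?card_ord // => i _.
by rewrite /tree_size /=; case: (tnth _ _) => [[]].
Qed.

(** * Filling the hole *)

Lemma contains_1342P s :
  reflect (exists a b c d, subseq [:: a; b; c; d] s /\ a < d < b /\ b < c)
          (contains_pattern [:: 1; 3; 4; 2] s).
Proof.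
have std t : standardize t = [:: 1; 3; 4; 2] <->
    exists a b c d, t = [:: a; b; c; d] /\ a < d < b /\ b < c.
  split=> [E|[a [b [c [d [-> lt_abcd]]]]]].
    have := congr1 size E; rewrite size_map.
    case: t E => [|a [|b [|c [|d []]]]] //= [] Ea Eb Ec Ed _.
    by exists a, b, c, d; split=> //; lia.
  by rewrite /standardize /=; repeat (congr (_ :: _); first by lia).
apply: (iffP existsP) => [[m /eqP/std[a [b [c [d [E H]]]]]]|].
  by exists a, b, c, d; rewrite -E mask_subseq.
move=> [a [b [c [d [/subseqP[m /eqP szm E] H]]]]]; exists (Tuple szm).
by apply/eqP/std; exists a, b, c, d.
Qed.

(** The extension in which the hole takes the value [k]: [bump k] raises the letters that are at
    least [k]. *)
Definition fill k u v := map (bump k) u ++ k :: map (bump k) v.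

Lemma subseq_mapE (f : nat -> nat) t s :
  subseq t (map f s) -> exists2 t', t = map f t' & subseq t' s.
Proof.
case/subseqP=> m _ ->; exists (mask m s); last exact: mask_subseq.
by rewrite map_mask.
Qed.

Lemma subseq_fillE k u v t : subseq t (fill k u v) ->
  exists s1 s2, [/\ subseq s1 u, subseq s2 v &
    t = map (bump k) s1 ++ map (bump k) s2 \/
    t = map (bump k) s1 ++ k :: map (bump k) s2].
Proof.
case/subseq_cat_consE=> [/subseq_catE|] [t1 [t2 [-> ]]].
  move=> /subseq_mapE[s1 -> ?] /subseq_mapE[s2 -> ?].
  by exists s1, s2; split=> //; left.
move=> /subseq_mapE[s1 -> ?] /subseq_mapE[s2 -> ?].
by exists s1, s2; split=> //; right.
Qed.

Lemma good_fill m u v : perm_eq (u ++ v) (iota 1 m) ->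
  good u v <->
  (forall k, 0 < k <= m.+1 -> ~~ contains_pattern [:: 1; 3; 4; 2] (fill k u v)).
Proof.
move=> /perm_mem mem_uv.
have le_u x : x \in u -> 0 < x <= m.
  by move=> xu; have := mem_uv x; rewrite mem_cat xu mem_iota; lia.
have le_v x : x \in v -> 0 < x <= m.
  by move=> xv; have := mem_uv x; rewrite mem_cat xv orbT mem_iota; lia.
split=> [[g1 g2 g3 g4] k _|avoid].
  apply/contains_1342P=> -[a [b [c [d [sub lt_abcd]]]]].
  have [s1 [s2 [s1u s2v]]] := subseq_fillE sub; clear sub.
  move=> [] E; have := congr1 size E; rewrite size_cat /= !size_map;
    case: s1 s1u E => [|x1 [|x2 [|x3 [|x4 [|x5 s1]]]]] s1u E //=;
    case: s2 s2v E => [|y1 [|y2 [|y3 [|y4 [|y5 s2]]]]] s2v //= [];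
    move=> Ea Eb Ec Ed _; move: lt_abcd; rewrite {}Ea {}Eb {}Ec {}Ed /bump.
  (* First the occurrences missing the hole, with 0 to 4 letters in [u]; then those in which the
     hole plays 1, 3, 4, 2. *)
  - by have := g2 _ _ _ (cons_subseq s2v); lia.
  - by have := g2 _ _ _ s2v; lia.
  - by have := g3 _ _ _ (mem_subseq s1u (mem_head _ _)) s2v; lia.
  - by have := g1 _ _ _ s1u; lia.
  - have := g1 _ _ _ (subseq_trans (prefix_subseq [:: x1; x2; x3] [:: x4]) s1u).
    by lia.
  - by have := g2 _ _ _ s2v; lia.
  - by have := g3 _ _ _ (mem_subseq s1u (mem_head _ _)) s2v; lia.
  - by have := g4 _ _ _ s1u (mem_subseq s2v (mem_head _ _)); lia.
  - by have := g1 _ _ _ s1u; lia.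
split.
- move=> x y z xyz; apply/negP=> lt_xyz.
  have [le_x le_z] : (0 < x <= m) /\ (0 < z <= m).
    by split; apply/le_u/(mem_subseq xyz); rewrite !inE eqxx ?orbT.
  (* In the four cases the hole is put next to one letter: just above [x] as the 2, just below [z]
     as the 1, just above [z] as the 3, just above [y] as the 4. *)
  have /negP[] := avoid x.+1 ltac:(lia).
  apply/contains_1342P; exists x, y.+1, z.+1, x.+1; split; last by lia.
  rewrite -[[:: _; _; _; _]]/([:: x; y.+1; z.+1] ++ [:: x.+1]) cat_subseq //.
    have -> : [:: x; y.+1; z.+1] = map (bump x.+1) [:: x; y; z].
      by rewrite /= /bump; congr [:: _; _; _]; lia.
    exact: map_subseq.
  by rewrite sub1seq mem_head.
- move=> x y z xyz; apply/negP=> lt_xyz.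
  have [le_x le_z] : (0 < y <= m) /\ (0 < z <= m).
    by split; apply/le_v/(mem_subseq xyz); rewrite !inE eqxx ?orbT.
  have /negP[] := avoid z ltac:(lia).
  apply/contains_1342P; exists z, x.+1, y.+1, z.+1; split; last by lia.
  rewrite -[[:: _; _; _; _]]cat0s cat_subseq ?sub0seq //= eqxx.
  have -> : [:: x.+1; y.+1; z.+1] = map (bump z) [:: x; y; z].
    by rewrite /= /bump; congr [:: _; _; _]; lia.
  exact: map_subseq.
- move=> x y z xu yz; apply/negP=> lt_xyz.
  have le_y : 0 < y <= m.
    by apply/le_v/(mem_subseq yz); rewrite !inE eqxx ?orbT.
  have /negP[] := avoid z.+1 ltac:(lia).
  apply/contains_1342P; exists x, z.+1, y.+1, z; split; last by lia.
  rewrite -[[:: _; _; _; _]]/([:: x] ++ [:: z.+1; y.+1; z]) cat_subseq //.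
    have -> : x = bump z.+1 x by rewrite /bump; lia.
    by rewrite sub1seq map_f.
  rewrite /= eqxx.
  have -> : [:: y.+1; z] = map (bump z.+1) [:: y; z].
    by rewrite /= /bump; congr [:: _; _]; lia.
  exact: map_subseq.
move=> x y z xy zv; apply/negP=> lt_xyz.
have le_y : 0 < y <= m.
  by apply/le_u/(mem_subseq xy); rewrite !inE eqxx ?orbT.
have /negP[] := avoid y.+1 ltac:(lia).
apply/contains_1342P; exists x, y, y.+1, z; split; last by lia.
rewrite -[[:: _; _; _; _]]/([:: x; y] ++ [:: y.+1; z]) cat_subseq //.
  have -> : [:: x; y] = map (bump y.+1) [:: x; y].
    by rewrite /= /bump; congr [:: _; _]; lia.
  exact: map_subseq.
rewrite /= eqxx sub1seq.
have -> : z = bump y.+1 z by rewrite /bump; lia.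
by rewrite map_f.
Qed.

(** * Words with one hole *)

Definition perm_word n (sigma : 'S_n) := [seq (sigma i).+1 | i <- enum 'I_n].

Lemma perm_word_iota n (sigma : 'S_n) : perm_eq (perm_word sigma) (iota 1 n).
Proof.
rewrite -[1]/(1 + 0) iotaDl -val_enum_ord -map_comp /perm_word.
rewrite (map_comp (fun i : 'I_n => i.+1) sigma).
apply/perm_map/uniq_perm; rewrite ?(map_inj_uniq perm_inj) ?enum_uniq // => i.
by rewrite mem_enum -[i](permKV sigma) map_f ?mem_enum.
Qed.

Lemma perm_word_onto n (s : seq nat) :
  perm_eq s (iota 1 n) -> exists sigma : 'S_n, perm_word sigma = s.
Proof.
move=> ps; have sz : size s = n by rewrite (perm_size ps) size_iota.
have nth_s i : i < n -> 0 < nth 0 s i <= n.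
  rewrite -{1}sz => /(mem_nth 0).
  by rewrite (perm_mem ps) mem_iota add1n ltnS.
have lt_f (i : 'I_n) : (nth 0 s i).-1 < n by have := nth_s i (ltn_ord i); lia.
have f_inj : injective (fun i => Ordinal (lt_f i)).
  move=> i j /(congr1 val) /= E; apply/val_inj/eqP => /=.
  rewrite -(nth_uniq 0 _ _ (_ : uniq s)) ?sz //.
    move: (nth_s i (ltn_ord i)) (nth_s j (ltn_ord j)) E.
    by move: (nth 0 s i) (nth 0 s j) => a b; lia.
  by rewrite (perm_uniq ps) iota_uniq.
exists (perm f_inj); apply: (@eq_from_nth _ 0).
  by rewrite size_map size_enum_ord.
move=> i; rewrite size_map size_enum_ord => lt_in.
rewrite (nth_map (Ordinal lt_in)) ?size_enum_ord // permE /= nth_enum_ord //.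
by have := nth_s i lt_in; lia.
Qed.

(** Forgetting the bound on the letters makes hole words comparable with pairs of words. *)
Definition letters n (pi : hole_word n) : seq (option nat) :=
  [seq omap (fun v : 'I_n.-1 => v.+1) (pi i) | i <- enum 'I_n].

Lemma size_letters n (pi : hole_word n) : size (letters pi) = n.
Proof. by rewrite size_map size_enum_ord. Qed.

Lemma letters_inj n : injective (@letters n).
Proof.
move=> pi pi' /eq_in_map E; apply/ffunP=> i; have := E i (mem_enum _ _).
by case: (pi i) (pi' i) => [x|] [y|] //= [] /val_inj ->.
Qed.

Definition around_hole (g : seq nat * seq nat) : seq (option nat) :=
  map Some g.1 ++ None :: map Some g.2.

Lemma around_hole_inj : injective around_hole.
Proof.
have idx g : index None (around_hole g) = size g.1.
  rewrite /around_hole index_cat size_map ifN ?addn0 //.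
  by apply/mapP=> -[].
move=> [u v] [u' v'] E; move: (congr1 (index None) E); rewrite !idx /= => sz.
move/eqP: E; rewrite eqseq_cat ?size_map // => /andP[/eqP Eu /eqP[Ev]].
by congr pair; apply: (inj_map Some_inj).
Qed.

Lemma letters_onto n u v : 0 < n -> perm_eq (u ++ v) (iota 1 n.-1) ->
  exists pi : hole_word n, letters pi = around_hole (u, v).
Proof.
move=> n_gt0 puv; pose w := around_hole (u, v).
have szw : size w = n.
  rewrite /w size_cat /= !size_map addnS -size_cat (perm_size puv) size_iota.
  exact: prednK.
(* [insub] would create a second hole on a letter out of range, but all letters lie between 1 and n
   - 1. *)
exists [ffun i : 'I_n => obind (fun k => insub k.-1) (nth None w i)].
apply: (@eq_from_nth _ None); rewrite size_letters // => i lt_in.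
rewrite (nth_map (Ordinal lt_in)) ?size_enum_ord // ffunE nth_enum_ord //.
have : nth None w i \in w by rewrite mem_nth ?szw.
case: (nth _ _ _) => // k; rewrite mem_cat inE /= !mem_map; try exact: Some_inj.
rewrite -mem_cat (perm_mem puv) mem_iota => k_n.
by rewrite insubT /=; [lia | move=> _; congr Some; lia].
Qed.

Lemma is_partial_perm1P n (pi : hole_word n) : 0 < n ->
  is_partial_perm1 pi <->
  exists u v, letters pi = around_hole (u, v) /\ perm_eq (u ++ v) (iota 1 n.-1).
Proof.
move=> n_gt0.
have cardE x : #|[set i | pi i == x]| =
    count_mem (omap (fun v : 'I_n.-1 => v.+1) x) (letters pi).
  rewrite cardsE cardE size_filter /letters count_map enumT.
  apply: eq_count => i; transitivity (pi i == x); first by [].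
  by rewrite /=; case: (pi i) x => [y|] [x|].
have Some_mem (w : seq nat) k : (Some k \in map Some w) = (k \in w).
  exact/mem_map/Some_inj.
split=> [/andP[/forallP letter1]|[u [v [E puv]]]].
  rewrite cardE => /eqP hole1.
  have : None \in letters pi by rewrite -has_pred1 has_count hole1.
  case/path.splitPr E: _ / => [w1 w2].
  have noHole w : None \notin w -> map Some (pmap id w) = w :> seq (option nat).
    by elim: w => [|[x|] w IHw] //=; rewrite inE => /IHw ->.
  have [Ew1 Ew2] : None \notin w1 /\ None \notin w2.
    move: hole1; rewrite E count_cat /= addnCA => /eqP.
    rewrite -[X in _ == X]addn0 eqn_add2l addn_eq0.
    by move=> /andP[/eqP/count_memPn ? /eqP/count_memPn].
  exists (pmap id w1), (pmap id w2).
  have {}E : letters pi = around_hole (pmap id w1, pmap id w2).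
    by rewrite /around_hole /= !noHole.
  split; first by rewrite /around_hole /= !noHole.
  rewrite perm_sym.
  (* Pigeonhole: all n - 1 values occur among n - 1 letters, so none is repeated and there are no
     others. *)
  have sub : {subset iota 1 n.-1 <= pmap id w1 ++ pmap id w2}.
    move=> k; rewrite mem_iota => k_n; have lt_k : k.-1 < n.-1 by lia.
    have := letter1 (Ordinal lt_k); rewrite cardE /= prednK ?E; last by lia.
    rewrite /around_hole -(Some_mem (_ ++ _)) map_cat => /eqP c1.
    have : Some k \in around_hole (pmap id w1, pmap id w2).
      by rewrite -has_pred1 has_count c1.
    by rewrite !mem_cat inE.
  have sz : size (pmap id w1 ++ pmap id w2) <= size (iota 1 n.-1).
    have := size_letters pi;
      rewrite E /around_hole size_cat /= !size_map size_cat size_iota.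
    by lia.
  have uniq_n := iota_uniq 1 n.-1.
  apply: uniq_perm => //; first exact: leq_size_uniq sub sz.
  by have [] := uniq_min_size uniq_n sub sz.
have countE k : count_mem (Some k) (letters pi) = count_mem k (iota 1 n.-1).
  rewrite -(seq.permP puv) E !count_cat /= add0n !count_map.
  by congr (_ + _); apply: eq_count => x /=; apply: (inj_eq Some_inj).
apply/andP; split; last first.
  rewrite cardE E /= count_cat /= !count_map.
  by rewrite !(eq_count (a2 := pred0)) ?count_pred0.
apply/forallP=> x; rewrite cardE countE count_uniq_mem ?iota_uniq // mem_iota.
by have := ltn_ord x; lia.
Qed.

Lemma mask_around_hole (T : Type) u v (s1 s2 : seq T) x :
  size s1 = size u -> size s2 = size v ->
  mask [seq c != None | c <- around_hole (u, v)] (s1 ++ x :: s2) = s1 ++ s2.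
Proof.
move=> sz1 sz2; have someE (s : seq nat) :
    [seq c != None | c <- map Some s] = nseq (size s) true.
  by elim: s => //= y s ->.
rewrite map_cat /= !someE mask_cat ?size_nseq //=.
by rewrite -sz1 -sz2 !mask_true.
Qed.

Lemma standardize_unbump n k s : perm_eq (k :: s) (iota 1 n) ->
  standardize s = map (unbump k) s.
Proof.
move=> ps; apply/eq_in_map => x xs.
have /andP[x_gt0 x_le] : 0 < x <= n.
  by have := perm_mem ps x; rewrite inE xs orbT mem_iota; lia.
have x_k : x != k.
  have := perm_uniq ps; rewrite iota_uniq /= => /andP[+ _].
  by apply: contraNneq => <-.
(* Exactly x entries of [k :: s] are at most x, so the rank of x in [s] is x, less one if k < x. *)
have := seq.permP ps (fun y => y <= x);
  rewrite /= -{1}(subnKC x_le) iotaD count_cat.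
have -> : count (leq^~ x) (iota 1 x) = x.
  rewrite -[RHS](size_iota 1) -count_predT; apply: eq_in_count => y.
  by rewrite mem_iota /=; lia.
have -> : count (leq^~ x) (iota (1 + x) (n - x)) = 0.
  apply/eqP; rewrite -leqn0 leqNgt -has_count; apply/hasPn=> y.
  by rewrite mem_iota /=; lia.
by rewrite /unbump; lia.
Qed.

(** Let [k] be the entry of [sigma] at the hole. Standardizing the rest is [unbump k], which
    [bump k] inverts on letters other than [k]. *)
Lemma is_extensionE n (pi : hole_word n) (sigma : 'S_n) u v :
  letters pi = around_hole (u, v) ->
  is_extension pi sigma <-> exists k, perm_word sigma = fill k u v.
Proof.
move=> E; have ps := perm_word_iota sigma.
have lettersE : nonhole_letters pi = u ++ v.
  have -> : nonhole_letters pi = pmap id (letters pi).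
    by rewrite /nonhole_letters /letters; elim: (enum _) => //= i s ->.
  rewrite E /around_hole pmap_cat /=.
  by congr (_ ++ _); rewrite map_pK.
have restrE : restrict_nonholes pi sigma =
    mask [seq c != None | c <- around_hole (u, v)] (perm_word sigma).
  rewrite /restrict_nonholes filter_mask map_mask -E; congr mask.
  by rewrite -[RHS]map_comp; apply: eq_map => i /=; case: (pi i).
have szE : size (perm_word sigma) = size u + (size v).+1.
  rewrite size_map size_enum_ord -(size_letters pi) E size_cat /= !size_map.
  by [].
rewrite /is_extension lettersE restrE; split=> [|[k Ek]].
  move: (perm_word sigma) ps szE => s ps szs.
  have szd : size (drop (size u) s) = (size v).+1 by rewrite size_drop szs
    addKn.
  have := cat_take_drop (size u) s.
  case: (drop _ _) szd => // k s2 [sz2] Es; rewrite -Es in ps *.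
  have sz1 : size (take (size u) s) = size u by rewrite size_takel // szs
    leq_addr.
  move: (take _ _) sz1 ps => s1 sz1 ps; rewrite mask_around_hole //.
  have {}ps : perm_eq (k :: s1 ++ s2) (iota 1 n).
    by rewrite -(permPr ps) -cat1s perm_catCA.
  rewrite (standardize_unbump ps) => /eqP Euv; exists k.
  have : map (bump k) (u ++ v) = s1 ++ s2.
    rewrite -Euv -map_comp map_id_in // => x xs /=; apply: unbumpK.
    have := perm_uniq ps; rewrite iota_uniq /= => /andP[+ _].
    by rewrite inE; apply: contraNneq => <-.
  rewrite map_cat => /eqP; rewrite eqseq_cat ?size_map //.
  by move=> /andP[/eqP <- /eqP <-].
rewrite Ek mask_around_hole ?size_map // -map_cat.
have pk : perm_eq (k :: map (bump k) (u ++ v)) (iota 1 n).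
  by rewrite -(permPr ps) Ek map_cat -cat1s perm_catCA.
rewrite (standardize_unbump pk) -map_comp map_id_in // => x _.
exact: bumpK.
Qed.

Lemma perm_fill m k u v : perm_eq (u ++ v) (iota 1 m) -> 0 < k <= m.+1 ->
  perm_eq (fill k u v) (iota 1 m.+1).
Proof.
move=> puv k_m; rewrite /fill -cat1s perm_catCA cat1s -map_cat.
have bump_inj : injective (bump k) := can_inj (bumpK k).
rewrite (permPl (_ : perm_eq _ (k :: map (bump k) (iota 1 m)))); last first.
  by rewrite perm_cons perm_map.
apply: uniq_perm; rewrite ?iota_uniq //.
  rewrite cons_uniq map_inj_uniq ?iota_uniq // andbT.
  by apply/mapP=> -[x _ /eqP]; rewrite (negbTE (neq_bump _ _)).
move=> x; rewrite inE mem_iota; apply/orP/idP => [[/eqP->|]|x_m].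
- by lia.
- by case/mapP=> y; rewrite mem_iota => y_m ->; rewrite /bump; lia.
case: (eqVneq x k) => [|x_k]; [by left | right].
apply/mapP; exists (unbump k x); last by rewrite unbumpK.
by rewrite mem_iota /unbump; lia.
Qed.

Lemma partial_avoids_fill n (pi : hole_word n) u v p : 0 < n ->
  letters pi = around_hole (u, v) -> perm_eq (u ++ v) (iota 1 n.-1) ->
  partial_avoids p pi <->
  (forall k, 0 < k <= n -> ~~ contains_pattern p (fill k u v)).
Proof.
move=> n_gt0 E puv; split=> [/forallP av k k_n|av].
  have [|sigma Es] := @perm_word_onto n (fill k u v).
    by rewrite -(prednK n_gt0); apply: perm_fill; rewrite ?prednK.
  rewrite -Es; apply: (implyP (av sigma)).
  by apply/(is_extensionE _ E); exists k.
apply/forallP=> sigma; apply/implyP=> /(is_extensionE _ E)[k Ek].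
rewrite /perm_avoids -/(perm_word sigma) Ek; apply: av.
have := perm_mem (perm_word_iota sigma) k; rewrite Ek mem_iota.
by rewrite mem_cat mem_head orbT; lia.
Qed.

(** Both sides become duplicate-free lists of words over [option nat] with the same members. *)
Lemma num_avoiders1_1342 n : 0 < n ->
  num_avoiders1 n [:: 1; 3; 4; 2] = empty_tree n.-1 1.
Proof.
move=> n_gt0;
  rewrite -size_good_pairs -(size_map around_hole) /num_avoiders1 cardE.
rewrite -(size_map (@letters n)); apply: perm_size; apply: uniq_perm.
- by rewrite (map_inj_uniq (@letters_inj n)) enum_uniq.
- by rewrite (map_inj_uniq around_hole_inj) uniq_good_pairs.
move=> w; apply/mapP/mapP => [[pi + ->]|[[u v] /mem_good_pairs[puv guv] ->]].
  rewrite mem_enum inE => /andP[/(is_partial_perm1P _ n_gt0)[u [v [E puv]]] av].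
  exists (u, v) => //; apply/mem_good_pairs; split=> //.
  by apply/(good_fill puv); rewrite prednK //;
    apply/(partial_avoids_fill _ n_gt0 E puv).
have [pi E] := letters_onto n_gt0 puv; exists pi => //.
rewrite mem_enum inE; apply/andP; split.
  by apply/(is_partial_perm1P _ n_gt0); exists u, v.
by apply/(partial_avoids_fill _ n_gt0 E puv); rewrite -{1}(prednK n_gt0);
  apply/good_fill.
Qed.

Theorem theorem31 (n : nat) (hn : 1 <= n) :
  ((num_avoiders1 n [:: 1; 3; 4; 2]%N)%:Z =
   (binomz (2 * n - 2)%N (n%:Z - 1))%:Z - (binomz (2 * n - 2)%N (n%:Z - 5))%:Z)%R.
Proof. by rewrite num_avoiders1_1342 // empty_tree_binz prednK. Qed.
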